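(* Let $d\ge1$, $\mathbb{N}=\{0,1,2,\dots\}$, $V^+,V^-:\mathbb{N}^d\to\mathbb{R}$, and consider the interacting random walk rates $c(\eta,\gamma_i^\pm)$ on $\mathbb{N}^d$ defined in the context. Suppose that for all $\eta\in\mathbb{N}^d$ and $i,j\in[d]$: $$\nabla_i^+c(\eta,\gamma_j^+)\le0,\qquad \nabla_i^+c(\eta,\gamma_j^-)\ge0,$$ $$\kappa^+(\eta,i):=-\nabla_i^+c(\eta,\gamma_i^+)-\sum_{j\in[d],\,j\ne i}\nabla_i^+c(\eta,\gamma_j^-)\ \ge 0,$$ $$\kappa^-(\eta,i):=\nabla_i^+c(\eta,\gamma_i^-)+\sum_{j\in[d],\,j\ne i}\nabla_i^+c(\eta,\gamma_j^+)\ \ge 0.$$ Set $$\kappa_*=\inf_{\eta\in\mathbb{N}^d,\,i\in[d]}\big(\kappa^+(\eta,i)+\kappa^-(\eta,i)\big),\qquad \overline{\kappa_*}=\min\Big\{\inf_{\eta,i}\kappa^+(\eta,i),\ \inf_{\eta,i}\kappa^-(\eta,i)\Big\}.$$ Let $\theta:(0,\infty)^2\to[0,\infty)$ be a weight function that is not identically $0$, symmetric, differentiable and concave. Then for all integers $N\ge2$ and all functions $\rho:\Omega_N\to(0,\infty)$ and $\psi:\Omega_N\to\mathbb{R}$, $$\mathscr{B}_N(\rho,\psi)\ \ge\ \Big(\frac{\kappa_*}{2}+M_\theta\,\overline{\kappa_*}\Big)\mathscr{A}_N(\rho,\psi).$$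
   Context: **Rates on $\mathbb{N}^d$.** $[d]=\{1,\dots,d\}$; $\mathbf{e}_i$ are the unit vectors. Moves: $\gamma_i^+\eta=\eta+\mathbf{e}_i$, $\gamma_i^-\eta=\eta-\mathbf{e}_i\mathbf{1}_{\eta_i>0}$. Rates: $c(\eta,\gamma_i^+)=\exp\big(-(V^+(\gamma_i^+\eta)-V^+(\eta))\big)$; $c(\eta,\gamma_i^-)=\exp\big(-(V^-(\gamma_i^-\eta)-V^-(\eta))\big)$ if $\eta_i>0$ and $c(\eta,\gamma_i^-)=0$ if $\eta_i=0$. The discrete gradient acts on the state variable: $\nabla_i^+c(\eta,\gamma)=c(\gamma_i^+\eta,\gamma)-c(\eta,\gamma)$. The reversible measure is $m=\frac1Z\exp(-V^+-V^-)$, assumed normalizable, with also $\sum_{\eta,\gamma} m(\eta)c(\eta,\gamma)<\infty$. **Localized chain.** For $N\ge2$: $\Omega_N=\{\eta\in\mathbb{N}^d:\eta_i\le N\ \forall i\}$, moves $G_N=\{\gamma_i^{+,N},\gamma_i^{-,N}:i\in[d]\}$ with $\gamma_i^{+,N}\eta=\eta+\mathbf{e}_i\mathbf{1}_{\eta_i<N}$, $\gamma_i^{-,N}\eta=\eta-\mathbf{e}_i\mathbf{1}_{\eta_i>0}$, rates $c_N(\eta,\gamma_i^{+,N})=c(\eta,\gamma_i^+)\mathbf{1}_{\eta_i<N}$, $c_N(\eta,\gamma_i^{-,N})=c(\eta,\gamma_i^-)$, and reversible probability measure $m_N=m/m(\Omega_N)$ on $\Omega_N$. Generator $\mathcal{L}_N\psi(\eta)=\sum_{\sigma\in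 G_N}c_N(\eta,\sigma)(\psi(\sigma\eta)-\psi(\eta))$; $S_N=\{(\eta,\sigma)\in\Omega_N\times G_N:c_N(\eta,\sigma)>0\}$. $$M_\theta=\inf_{s,t>0:\ \theta(s,t)>0}\frac{\theta(s,s)+\theta(t,t)}{2\theta(s,t)}\in[0,1].$$ For $\rho:\Omega_N\to(0,\infty)$, $\psi:\Omega_N\to\mathbb{R}$: $$\mathscr{A}_N(\rho,\psi)=\tfrac12\sum_{(\eta,\sigma)\in S_N}m_N(\eta)c_N(\eta,\sigma)\,\theta(\rho(\eta),\rho(\sigma\eta))\,[\psi(\eta)-\psi(\sigma\eta)]^2,$$ $$\mathscr{C}_N(\rho,\psi)=\tfrac14\sum_{(\eta,\sigma)\in S_N}m_N(\eta)c_N(\eta,\sigma)\Big\{\partial_1\theta(\rho(\eta),\rho(\sigma\eta))\,\mathcal{L}_N\rho(\eta)+\partial_2\theta(\rho(\eta),\rho(\sigma\eta))\,\mathcal{L}_N\rho(\sigma\eta)\Big\}[\psi(\eta)-\psi(\sigma\eta)]^2,$$ $$\mathscr{D}_N(\rho,\psi)=\tfrac12\sum_{(\eta,\sigma)\in S_N}m_N(\eta)c_N(\eta,\sigma)\,\theta(\rho(\eta),\rho(\sigma\eta))(\psi(\eta)-\psi(\sigma\eta))(\mathcal{L}_N\psi(\eta)-\mathcal{L}_N\psi(\sigma\eta)),$$ and $\mathscr{B}_N=\mathscr{C}_N-\mathscr{D}_N$. *)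

(* Defs.v *)
From HB Require Import structures.
From mathcomp Require Import all_boot all_order all_algebra.
From mathcomp Require Import all_classical all_reals all_analysis.

Set Implicit Arguments.
Unset Strict Implicit.
Unset Printing Implicit Defensive.

Import Order.TTheory GRing.Theory Num.Theory.
Import numFieldNormedType.Exports.

Local Open Scope classical_set_scope.
Local Open Scope ring_scope.

(** * The interacting random walk on N^d *)

Definition state (d : nat) := {ffun 'I_d -> nat}.

(* [(i, true)] is gamma_i^+ and [(i, false)] is gamma_i^-. *)
Definition move (d : nat) := ('I_d * bool)%type.
Definition move_up (d : nat) (i : 'I_d) : move d := (i, true).
Definition move_down (d : nat) (i : 'I_d) : move d := (i, false).

(* Subtraction on nat is truncated, so gamma_i^- fixes eta when eta_i = 0. *)
Definition move_act (d : nat) (g : move d) (eta : state d) : state d :=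
  [ffun j => if j == g.1 then (if g.2 then (eta j).+1 else (eta j - 1)%N)
             else eta j].

Section Rates.
Variables (R : realType) (d : nat) (Vp Vm : state d -> R).

Definition rate (eta : state d) (g : move d) : R :=
  if g.2 then expR (- (Vp (move_act g eta) - Vp eta))
  else if (0 < eta g.1)%N then expR (- (Vm (move_act g eta) - Vm eta))
  else 0.

(* nabla_i^+ c(eta, g): the move [g] is kept fixed. *)
Definition grad_rate (i : 'I_d) (eta : state d) (g : move d) : R :=
  rate (move_act (move_up i) eta) g - rate eta g.

Definition gibbs_weight (eta : state d) : R := expR (- Vp eta - Vm eta).

Definition partition_function : \bar R :=
  \esum_(eta in [set: state d]) (gibbs_weight eta)%:E.

Definition rev_measure (eta : state d) : R :=
  (fine partition_function)^-1 * gibbs_weight eta.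

Definition total_rate : \bar R :=
  \esum_(p in [set: state d * move d])
    (rev_measure p.1 * rate p.1 p.2)%:E.

Definition kappa_plus (eta : state d) (i : 'I_d) : R :=
  - grad_rate i eta (move_up i)
  - \sum_(j < d | j != i) grad_rate i eta (move_down j).

Definition kappa_minus (eta : state d) (i : 'I_d) : R :=
  grad_rate i eta (move_down i)
  + \sum_(j < d | j != i) grad_rate i eta (move_up j).

Definition inf_state_idx (f : state d -> 'I_d -> R) : R :=
  inf [set f p.1 p.2 | p in [set: state d * 'I_d]].

Definition kappa_star : R :=
  inf_state_idx (fun eta i => kappa_plus eta i + kappa_minus eta i).

Definition kappa_star_bar : R :=
  Num.min (inf_state_idx kappa_plus) (inf_state_idx kappa_minus).

End Rates.

(** * Weight functions *)

Section Weight.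
Variable R : realType.

(* A weight is a function on (0, oo)^2; it is represented by a function on the
   whole plane, whose values off this quadrant are never used. *)
Definition quadrant : set (R * R) := [set x | 0 < x.1 /\ 0 < x.2].

Definition concave_on (D : set (R^o * R^o)) (f : R^o * R^o -> R^o) : Prop :=
  convex_function D (fun x => - f x).

Record weight_function (theta : R * R -> R) : Prop := WeightFunction {
  weight_ge0 : forall x, quadrant x -> 0 <= theta x;
  weight_not_zero : exists2 x, quadrant x & theta x != 0;
  weight_sym : forall s t, quadrant (s, t) -> theta (s, t) = theta (t, s);
  weight_diff : forall x, quadrant x -> differentiable theta x;
  weight_concave : concave_on quadrant theta
}.

Definition partial1 (theta : R * R -> R) (s t : R) : R :=
  derive1 (fun u : R => theta (u, t)) s.
Definition partial2 (theta : R * R -> R) (s t : R) : R :=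
  derive1 (fun u : R => theta (s, u)) t.

Definition M_weight (theta : R * R -> R) : R :=
  inf [set (theta (x.1, x.1) + theta (x.2, x.2)) / (2 * theta x)
      | x in [set x | quadrant x /\ 0 < theta x]].

End Weight.

(** * The localized chain *)

Definition box (d N : nat) := {ffun 'I_d -> 'I_N.+1}.

Definition emb (d N : nat) (eta : box d N) : state d :=
  [ffun j => eta j : nat].

(* [inord] is only applied to values that are at most N. *)
Definition box_act (d N : nat) (g : move d) (eta : box d N) : box d N :=
  [ffun j => if j == g.1 then
               (if g.2 then inord (eta j + (eta j < N)) else inord (eta j - 1))
             else eta j].

Section Localized.
Variables (R : realType) (d : nat) (Vp Vm : state d -> R) (N : nat).
Implicit Types (eta : box d N) (g : move d).

Definition box_rate eta g : R :=
  if g.2 then rate Vp Vm (emb eta) g * (eta g.1 < N)%:R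
  else rate Vp Vm (emb eta) g.

Definition box_measure eta : R :=
  rev_measure Vp Vm (emb eta)
  / \sum_(xi : box d N) rev_measure Vp Vm (emb xi).

Definition box_gen (psi : box d N -> R) eta : R :=
  \sum_(g : move d) box_rate eta g * (psi (box_act g eta) - psi eta).

Definition box_support : {set box d N * move d} :=
  [set p | 0 < box_rate p.1 p.2]%SET.

Section Functionals.
Variables (theta : R * R -> R) (rho psi : box d N -> R).

Definition action_A : R :=
  2^-1 * \sum_(p in box_support)
    box_measure p.1 * box_rate p.1 p.2
    * theta (rho p.1, rho (box_act p.2 p.1))
    * (psi p.1 - psi (box_act p.2 p.1)) ^+ 2.

Definition functional_C : R :=
  4^-1 * \sum_(p in box_support)
    box_measure p.1 * box_rate p.1 p.2
    * (partial1 theta (rho p.1) (rho (box_act p.2 p.1)) * box_gen rho p.1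
       + partial2 theta (rho p.1) (rho (box_act p.2 p.1))
         * box_gen rho (box_act p.2 p.1))
    * (psi p.1 - psi (box_act p.2 p.1)) ^+ 2.

Definition functional_D : R :=
  2^-1 * \sum_(p in box_support)
    box_measure p.1 * box_rate p.1 p.2
    * theta (rho p.1, rho (box_act p.2 p.1))
    * (psi p.1 - psi (box_act p.2 p.1))
    * (box_gen psi p.1 - box_gen psi (box_act p.2 p.1)).

Definition functional_B : R := functional_C - functional_D.

End Functionals.
End Localized.

(* Main.v *)
Require Import Defs.
From mathcomp Require Import all_boot all_order all_algebra.
From mathcomp Require Import all_classical all_reals all_analysis.
From mathcomp Require Import ring lra.

Import Order.TTheory GRing.Theory Num.Theory.
Import numFieldNormedType.Exports.

Local Open Scope ring_scope.

(** Along an edge from [x] to [y = x + e_i] the two generators are compared by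
    coupling the moves from [x] with the moves from [y]:
    - the same move on both sides, at the smaller of the two rates;
    - [gamma_i^+] at [x] with [gamma_j^-] at [y] (j <> i), at the excess rate
      [nabla_i^+ c(x, gamma_j^-)];
    - [gamma_j^+] at [x] with [gamma_i^-] at [y] (j <> i), at the excess rate
      [- nabla_i^+ c(x, gamma_j^+)];
    - [gamma_i^+] at [x] alone and [gamma_i^-] at [y] alone, at the remaining
      rates, which are [kappa^+] and [kappa^-].
    Concavity of theta and a (b - a) <= (b^2 - a^2) / 2 bound the integrand of
    C - D from below, for a coupled jump to [(x', y')], by half of
    theta(x', y') (psi x - psi y)^2 - theta(x, y) (psi x' - psi y')^2.
    By reversibility these differences sum to zero over the first three kinds of
    jumps. Jumps of the last kind make the two points meet; there b = 0 and
    the elementary inequality leaves a^2 / 2 to spare, which gives kappa_* / 2,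
    while theta on the diagonal is bounded below through M_theta. *)

(** * Weight functions: tangent planes and the constant M_theta *)

Lemma eq_derive_line {R : numFieldType} {U V W : normedModType R}
    {f : U -> W} {g : V -> W} {a v b w} :
  (forall h : R, f (h *: v + a) = g (h *: w + b)) -> 'D_v f a = 'D_w g b.
Proof.
move=> fg; have fa := fg 0; rewrite !scale0r !add0r in fa.
rewrite /derive; suff -> : (fun h : R => h^-1 *: ((f \o shift a) (h *: v) - f a)) =
  (fun h : R => h^-1 *: ((g \o shift b) (h *: w) - g b)) by [].
by apply/funext => h /=; rewrite fg fa.
Qed.

Section Weight.
Context {R : realType} {theta : R * R -> R} (htheta : weight_function theta).

(** Concavity on the segment from [x] to [y], arranged so that division by [h] leaves a difference
    quotient at [x]. *)
Lemma weight_chord (x y : R * R) (h : R) :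
  quadrant x -> quadrant y -> 0 <= h -> h <= 1 ->
  h * (theta y - theta x) <= theta (h *: (y - x) + x) - theta x.
Proof.
move=> qx qy h0 h1.
have := weight_concave htheta (Itv01 h0 h1) (mem_set qy) (mem_set qx).
rewrite /conv /= /unstable.onem.
have -> : h *: y + (1 - h) *: x = h *: (y - x) + x.
  by rewrite scalerBr scalerBl scale1r addrA addrAC.
rewrite /GRing.scale /=; set P := theta y; set Q := theta x; set S := theta _.
change (- S <= h * - P + (1 - h) * - Q -> h * (P - Q) <= S - Q).
by move=> H; lra.
Qed.

(** Differentiability makes the directional derivative linear in the direction, so the two
    coordinate directions determine it. *)
Lemma derive_weight (s t a b : R) : quadrant (s, t) ->
  'D_((a, b) : R * R) theta (s, t) = partial1 theta s t * a + partial2 theta s t * b.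
Proof.
move=> q; have dth := weight_diff htheta q.
have p1 : partial1 theta s t = 'd theta (s, t) (1, 0).
  rewrite -deriveE // /partial1 derive1E; apply: eq_derive_line => h.
  congr (theta _); apply/esym/pair_equal_spec; split;
    by rewrite /= /GRing.scale /= ?mulr0 ?add0r ?mulr1.
have p2 : partial2 theta s t = 'd theta (s, t) (0, 1).
  rewrite -deriveE // /partial2 derive1E; apply: eq_derive_line => h.
  congr (theta _); apply/esym/pair_equal_spec; split;
    by rewrite /= /GRing.scale /= ?mulr0 ?add0r ?mulr1.
rewrite deriveE // p1 p2 mulrC (mulrC _ b).
have -> : (a, b) = a *: (1, 0) + b *: (0, 1) :> R * R.
  by apply/pair_equal_spec; split; rewrite /= /GRing.scale /= ?mulr0 ?mulr1 ?addr0 ?add0r.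
have D := linearD ('d theta (s, t)); have Z := linearZZ ('d theta (s, t)).
by rewrite D !Z.
Qed.

Lemma weight_tangent (s t s' t' : R) : quadrant (s, t) -> quadrant (s', t') ->
  theta (s', t') <= theta (s, t) + partial1 theta s t * (s' - s)
                    + partial2 theta s t * (t' - t).
Proof.
move=> q q'; rewrite -addrA -lerBlDl -derive_weight //.
have /diff_derivable dv := weight_diff htheta q.
have {}dv := dv ((s' - s), (t' - t)).
(* The chord inequality is available only for [h] in (0, 1], so the derivative is computed as a
   limit from the right. *)
rewrite /derive cvg_at_rightE; last exact: dv.
apply: limr_ge.
  apply/cvg_ex; exists ('D_(s' - s, t' - t) theta (s, t)).
  exact: cvg_dnbhs_at_right dv.
near=> h.
have h0 : 0 < h by near: h; exact: nbhs_right_gt.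
have h1 : h <= 1 by near: h; exact: nbhs_right_le.
rewrite ler_pdivlMl //.
by have := @weight_chord (s, t) (s', t') h q q' (ltW h0) h1.
Unshelve. all: by end_near.
Qed.

Lemma M_weight_le (s t : R) : quadrant (s, t) ->
  2 * M_weight theta * theta (s, t) <= theta (s, s) + theta (t, t).
Proof.
move=> q; have [s0 t0] := q.
have ss : 0 <= theta (s, s) by apply: weight_ge0.
have tt : 0 <= theta (t, t) by apply: weight_ge0.
(* If [theta (s, t)] is 0, the pair is outside the range of the infimum, but the left side is then
   0. *)
have := weight_ge0 htheta q; rewrite le_eqVlt => /predU1P[<-|pos].
  by rewrite mulr0 addr_ge0.
have le : M_weight theta <= (theta (s, s) + theta (t, t)) / (2 * theta (s, t)).
  apply: ge_inf; last by exists (s, t).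
  exists 0 => _ [[a b] [[/= a0 b0] ab] <-].
  by rewrite divr_ge0 ?mulr_ge0 ?addr_ge0 ?(ltW ab) //; apply: weight_ge0.
by move: le; rewrite ler_pdivlMr ?mulr_gt0 // => le; nra.
Qed.

End Weight.

(** * Cancellations in a finite reversible birth-death chain *)

Lemma sum_antisym (R : realFieldType) (I : finType) (g : I -> I -> R) :
  (forall i j, j != i -> g i j = - g j i) -> \sum_i \sum_(j | j != i) g i j = 0.
Proof.
move=> gN; set S := LHS.
suff : S = - S by lra.
rewrite {1}/S (exchange_big_dep xpredT) //= -sumrN; apply: eq_bigr => j _.
rewrite -sumrN; apply: eq_big => [i|i]; first by rewrite eq_sym.
by move=> /gN.
Qed.

Section BirthDeath.
Context {R : realFieldType} {E I : finType}.
(** [p i] and [q i] are the rates of the moves [u i] and [l i]. A rate vanishes where the boundary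
    blocks the move, hence the guards below. [p_path] and [q_path] say that two moves in the same
    sense have the same product of rates in either order. *)
Variables (u l : I -> E -> E) (p q : I -> E -> R) (m : E -> R).
Hypothesis m_ge0 : forall x, 0 <= m x.
Hypothesis p_ge0 : forall i x, 0 <= p i x.
Hypothesis q_ge0 : forall i x, 0 <= q i x.
Hypothesis upK : forall i x, p i x != 0 -> l i (u i x) = x.
Hypothesis downK : forall i x, q i x != 0 -> u i (l i x) = x.
Hypothesis q_up : forall i x, p i x != 0 -> q i (u i x) != 0.
Hypothesis p_down : forall i x, q i x != 0 -> p i (l i x) != 0.
Hypothesis balance : forall i x, p i x != 0 -> m x * p i x = m (u i x) * q i (u i x).
Hypothesis upC : forall i j x, u i (u j x) = u j (u i x).
Hypothesis up_downC : forall i j x, i != j -> u i (l j x) = l j (u i x).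
Hypothesis p_path : forall i j x, p i x * p j (u i x) = p j x * p i (u j x).
Hypothesis q_path : forall i j x, q i x * q j (l i x) = q j x * q i (l j x).

(** Detailed balance, after reindexing by the bijection [u i] from the states with [p i x != 0] to
    those with [q i x != 0]. *)
Lemma sum_reversal i (F : E -> E -> R) :
  \sum_x m x * q i x * F x (l i x) = \sum_x m x * p i x * F (u i x) x.
Proof.
transitivity (\sum_(x | q i x != 0) m x * q i x * F x (l i x)).
  rewrite [LHS](bigID (fun x => q i x != 0)) /= [X in _ + X]big1 ?addr0 // => x.
  by rewrite negbK => /eqP->; rewrite mulr0 mul0r.
rewrite (reindex_onto (u i) (l i)) => [|x]; last exact: downK.
transitivity (\sum_(x | p i x != 0) m x * p i x * F (u i x) x); last first.
  rewrite [RHS](bigID (fun x => p i x != 0)) /= [X in _ = _ + X]big1 ?addr0 // => x.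
  by rewrite negbK => /eqP->; rewrite mulr0 mul0r.
apply: eq_big => x.
  apply/andP/idP => [[/p_down + /eqP lu]|px]; first by rewrite lu.
  by rewrite q_up // upK.
by case/andP => /p_down + /eqP lu; rewrite !lu => px; rewrite balance.
Qed.

Section Exchange.
Variables Phi Psi : E -> E -> R.
Hypothesis PhiC : forall x y, Phi x y = Phi y x.
Hypothesis PsiC : forall x y, Psi x y = Psi y x.

(* Contribution of a coupled jump of the edge [(x, y)] to the edge [(a, b)]. *)
Definition exchange x y a b : R := Phi a b * Psi x y - Phi x y * Psi a b.

Lemma exchangeN x y a b : exchange x y a b = - exchange a b x y.
Proof. by rewrite /exchange opprB. Qed.

Lemma exchangeCl x y a b : exchange x y a b = exchange y x a b.
Proof. by rewrite /exchange PsiC PhiC (PhiC x y) (PhiC b a). Qed.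

Lemma exchangeCr x y a b : exchange x y a b = exchange x y b a.
Proof. by rewrite /exchange (PhiC b a) (PsiC b a). Qed.

(** On the square spanned by [u i] and [u j] at [x], reversal turns the down jumps in direction [j]
    into the reverses of the up jumps. The weights agree by [p_path], and [exchange] is
    antisymmetric. *)
Lemma parallel_moves_cancel i j :
  \sum_x m x * p i x * (p j (u i x) * exchange x (u i x) (u j x) (u j (u i x))
    + q j x * exchange x (u i x) (l j x) (u i (l j x))) = 0.
Proof.
under eq_bigr do rewrite mulrDr.
rewrite big_split /=.
transitivity (\sum_x m x * p i x * p j (u i x) *
    exchange x (u i x) (u j x) (u j (u i x))
  + \sum_x m x * q j x * (p i x * exchange x (u i x) (l j x) (u i (l j x)))).
  by congr (_ + _); apply: eq_bigr => x _; ring.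
rewrite (sum_reversal j (fun x y => p i x * exchange x (u i x) y (u i y))).
rewrite -big_split big1 //= => x _.
rewrite exchangeN (upC j i) -(mulrA (m x)) p_path; ring.
Qed.

(** The jump joins two edges with the same lower end [x]. Its weight is symmetric in [i] and [j] by
    [p_path], while [exchange] changes sign. *)
Lemma up_moves_cancel :
  \sum_i \sum_(j | j != i) \sum_x m x * p i x *
    ((p j x - p j (u i x)) * exchange x (u i x) (u j x) x) = 0.
Proof.
apply: sum_antisym => i j _; rewrite -sumrN; apply: eq_bigr => x _.
rewrite exchangeCr exchangeN (exchangeCr x (u j x)).
have := p_path i j x; set X := exchange _ _ _ _ => e.
have -> : m x * p i x * ((p j x - p j (u i x)) * - X) =
  - m x * X * (p i x * p j x - p i x * p j (u i x)) by ring.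
rewrite e; ring.
Qed.

(** After reversal both edges have the same upper end, and [q_path] makes the weight symmetric in
    [i] and [j]. *)
Lemma down_moves_cancel :
  \sum_i \sum_(j | j != i) \sum_x m x * p i x *
    ((q j (u i x) - q j x) * exchange x (u i x) (u i x) (l j (u i x))) = 0.
Proof.
under eq_bigr => i _ do under eq_bigr => j _ do rewrite
  -(sum_reversal i (fun y x => (q j y - q j x) * exchange x y y (l j y))).
apply: sum_antisym => i j _; rewrite -sumrN; apply: eq_bigr => x _.
rewrite exchangeCl exchangeCr exchangeN (exchangeCl (l j x)) (exchangeCl x (l j x)).
rewrite (exchangeCr (l j x) x x).
have := q_path i j x; set X := exchange _ _ _ _ => e.
have -> : m x * q i x * ((q j x - q j (l i x)) * - X) =
  - m x * X * (q i x * q j x - q i x * q j (l i x)) by ring.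
rewrite e; ring.
Qed.

End Exchange.

(** * The coupling along an edge and the abstract inequality *)

Definition gen (f : E -> R) x : R :=
  \sum_i (p i x * (f (u i x) - f x) + q i x * (f (l i x) - f x)).

(** The rate of [u i] at [x] left unpaired by the coupling; [kminus] is likewise that of [l i] at
    [u i x]. *)
Definition kplus i x : R :=
  p i x - p i (u i x) - \sum_(j | j != i) (q j (u i x) - q j x).

Definition kminus i x : R :=
  q i (u i x) - q i x + \sum_(j | j != i) (p j (u i x) - p j x).

(* The rates of the coupling have the rates of the chain as marginals. *)
Lemma coupling_split (A B : E -> R) i x (y := u i x) :
  l i y = x -> A x = 0 -> B y = 0 ->
  \sum_j (p j x * A (u j x) + q j x * A (l j x))
  + \sum_j (p j y * B (u j y) + q j y * B (l j y)) =
  \sum_j (p j y * (A (u j x) + B (u j y)) + q j x * (A (l j x) + B (l j y)))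
  + \sum_(j | j != i) (q j y - q j x) * (A y + B (l j y))
  + \sum_(j | j != i) (p j x - p j y) * (A (u j x) + B x)
  + kplus i x * (A y + B y) + kminus i x * (A x + B x).
Proof.
move=> ly Ax By; rewrite /kplus /kminus -/y.
rewrite (bigD1 i) //= [X in _ + X](bigD1 i) //= [in RHS](bigD1 i) //= -/y ly Ax By.
set a := \sum_(_ | _) _; set b := \sum_(_ | _) _; set c := \sum_(_ | _) _.
set e := \sum_(_ | _) _; set f := \sum_(_ | _) _; set g := \sum_(_ | _) _.
set h := \sum_(_ | _) _.
(* For [j != i], pairing the excess moves adds an [A y] or a [B x]; the last two terms remove them,
   and [g] and [h] are the sums in [kplus] and [kminus]. *)
have : a + b = c + e + f - g * A y + h * B x.
  rewrite /a /b /c /e /f /g /h !mulr_suml -!sumrN -!big_split /=.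
  by apply: eq_bigr => j ji; ring.
move: a b c e f g h => a b c e f g h abc.
transitivity (p i x * A y + p i y * B (u i y) + q i x * A (l i x) + q i y * B x
  + (a + b)); first by ring.
rewrite abc; ring.
Qed.

Section Functionals.
Variables (rho psi : E -> R) (Phi D1 D2 : E -> E -> R).
Hypothesis Phi_ge0 : forall x y, 0 <= Phi x y.
Hypothesis PhiC : forall x y, Phi x y = Phi y x.
Hypothesis Phi_tangent : forall x y a b,
  Phi a b <= Phi x y + D1 x y * (rho a - rho x) + D2 x y * (rho b - rho y).
Hypothesis q_mono : forall i j x, p i x != 0 -> q j x <= q j (u i x).
Hypothesis p_anti : forall i j x, p i x != 0 -> p j (u i x) <= p j x.

Let Psi x y : R := (psi x - psi y) ^+ 2.
Let PsiC x y : Psi x y = Psi y x.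
Proof. by rewrite /Psi -sqrrN opprB. Qed.

(* Integrand of C - D on the edge [(x, y)], where [Phi x y], [D1 x y], [D2 x y] stand for
   theta and its partial derivatives at [(rho x, rho y)]. *)
Definition edge_form x y : R :=
  4^-1 * (D1 x y * gen rho x + D2 x y * gen rho y) * Psi x y
  - 2^-1 * (Phi x y * (psi x - psi y) * (gen psi x - gen psi y)).

Lemma gen_affine (a b : R) (f g : E -> R) x :
  \sum_i (p i x * (a * (f (u i x) - f x) + b * (g (u i x) - g x))
     + q i x * (a * (f (l i x) - f x) + b * (g (l i x) - g x))) =
  a * gen f x + b * gen g x.
Proof. by rewrite /gen !mulr_sumr -big_split /=; apply: eq_bigr => i _; ring. Qed.

(* The slopes [d1], [d2] are arbitrary because the lemma is applied to both orientations of
   the edge, which exchange the two partial derivatives of theta. *)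
Lemma edge_bound i x d1 d2 (y := u i x) :
  p i x != 0 -> 0 <= kplus i x -> 0 <= kminus i x ->
  (forall a b, Phi a b <= Phi x y + d1 * (rho a - rho x) + d2 * (rho b - rho y)) ->
  \sum_j (p j y * exchange Phi Psi x y (u j x) (u j y)
          + q j x * exchange Phi Psi x y (l j x) (u i (l j x)))
  + \sum_(j | j != i) (q j y - q j x) * exchange Phi Psi x y y (l j y)
  + \sum_(j | j != i) (p j x - p j y) * exchange Phi Psi x y (u j x) x
  + kplus i x * (Phi y y + Phi x y) * Psi x y
  + kminus i x * (Phi x x + Phi x y) * Psi x y
  <= (d1 * gen rho x + d2 * gen rho y) * Psi x y
     - 2 * (Phi x y * (psi x - psi y) * (gen psi x - gen psi y)).
Proof.
move=> px kp km tangent.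
set a := psi x - psi y.
(* [A z] and [B z] are the contributions to the right side of a jump from [x], respectively from
   [y], to [z]. *)
pose A z := d1 * Psi x y * (rho z - rho x) + - 2 * Phi x y * a * (psi z - psi x).
pose B z := d2 * Psi x y * (rho z - rho y) + 2 * Phi x y * a * (psi z - psi y).
have PsiE : Psi x y = a ^+ 2 by [].
(* With [b = psi z - psi w], the gap is [a ^+ 2] times the tangent gap plus
   [Phi x y * (b - a) ^+ 2]. *)
have AB z w : exchange Phi Psi x y z w <= A z + B w.
  have := tangent z w; rewrite -subr_ge0 => /(mulr_ge0 (sqr_ge0 a)) h1.
  have h2 := mulr_ge0 (Phi_ge0 x y) (sqr_ge0 (psi z - psi w - a)).
  rewrite -subr_ge0; apply: (le_trans (addr_ge0 h1 h2)); rewrite le_eqVlt; apply/orP; left.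
  by apply/eqP; rewrite /exchange /A /B PsiE /Psi /a; ring.
(* Here [b = 0], and the square is kept as the gain [Phi x y * a ^+ 2]. *)
have ABdiag z : (Phi z z + Phi x y) * Psi x y <= A z + B z.
  have := tangent z z; rewrite -subr_ge0 => /(mulr_ge0 (sqr_ge0 a)) h1.
  rewrite -subr_ge0; apply: (le_trans h1); rewrite le_eqVlt; apply/orP; left.
  by apply/eqP; rewrite /A /B PsiE /a; ring.
have Ax : A x = 0 by rewrite /A !subrr; ring.
have By : B y = 0 by rewrite /B !subrr; ring.
have -> : (d1 * gen rho x + d2 * gen rho y) * Psi x y
     - 2 * (Phi x y * a * (gen psi x - gen psi y)) =
  \sum_j (p j x * A (u j x) + q j x * A (l j x))
  + \sum_j (p j y * B (u j y) + q j y * B (l j y)).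
  by rewrite /A /B !gen_affine; ring.
rewrite (@coupling_split A B i x (upK _ _ px) Ax By) -/y.
rewrite !lerD //.
- apply: ler_sum => j _; apply: lerD; first by rewrite ler_wpM2l.
  (* For [j = i] the moves [u i] and [l i] need not commute: either [q i x = 0] and the term
     vanishes, or both orders return to [x]. *)
  have [<-|ij] := eqVneq i j; last by rewrite -up_downC // ler_wpM2l.
  have [->|qx] := eqVneq (q i x) 0; first by rewrite !mul0r.
  by rewrite downK // /y (upK _ _ px) ler_wpM2l.
- by apply: ler_sum => j _; rewrite ler_wpM2l // subr_ge0 q_mono.
- by apply: ler_sum => j _; rewrite ler_wpM2l // subr_ge0 p_anti.
- by rewrite -mulrA ler_wpM2l.
- by rewrite -mulrA ler_wpM2l.
Qed.

Lemma sum_edge_form_ge (K1 K2 M : R) :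
  0 <= K2 ->
  (forall i x, p i x != 0 -> K1 <= kplus i x + kminus i x) ->
  (forall i x, p i x != 0 -> K2 <= kplus i x) ->
  (forall i x, p i x != 0 -> K2 <= kminus i x) ->
  (forall x y, 2 * M * Phi x y <= Phi x x + Phi y y) ->
  (K1 / 2 + M * K2) * (2^-1 * \sum_x \sum_i
    (m x * p i x * (Phi x (u i x) * Psi x (u i x))
     + m x * q i x * (Phi x (l i x) * Psi x (l i x))))
  <= \sum_x \sum_i (m x * p i x * edge_form x (u i x)
     + m x * q i x * edge_form x (l i x)).
Proof.
move=> K20 K1le K2p K2m Mle.
(* By reversal each edge is counted once, from its lower end, with both orientations. *)
have updown (F : E -> E -> R) : \sum_x \sum_i (m x * p i x * F x (u i x)
     + m x * q i x * F x (l i x)) =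
   \sum_i \sum_x m x * p i x * (F x (u i x) + F (u i x) x).
  rewrite exchange_big; apply: eq_bigr => i _; rewrite big_split sum_reversal -big_split.
  by apply: eq_bigr => x _; rewrite /= -mulrDr.
rewrite (updown (fun x y => Phi x y * Psi x y)) updown.
have zero : \sum_i \sum_x m x * p i x * (
   \sum_j (p j (u i x) * exchange Phi Psi x (u i x) (u j x) (u j (u i x))
          + q j x * exchange Phi Psi x (u i x) (l j x) (u i (l j x)))
   + \sum_(j | j != i) (q j (u i x) - q j x) * exchange Phi Psi x (u i x) (u i x) (l j (u i x))
   + \sum_(j | j != i) (p j x - p j (u i x)) * exchange Phi Psi x (u i x) (u j x) x) = 0.
  under eq_bigr do under eq_bigr do rewrite !mulrDr.
  under eq_bigr do rewrite !big_split /=.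
  rewrite !big_split /=.
  rewrite [X in X + _ + _]big1 => [|i _]; last first.
    under eq_bigr do rewrite mulr_sumr.
    rewrite exchange_big big1 //= => j _; exact: parallel_moves_cancel.
  rewrite [X in _ + X + _](_ : _ = 0) ?[X in _ + X](_ : _ = 0) ?addr0 //.
    rewrite -[RHS](up_moves_cancel _ _ PhiC PsiC); apply: eq_bigr => i _.
    by under eq_bigr do rewrite mulr_sumr; rewrite exchange_big.
  rewrite -[RHS](down_moves_cancel _ _ PhiC PsiC); apply: eq_bigr => i _.
  by under eq_bigr do rewrite mulr_sumr; rewrite exchange_big.
(* [edge_form] is a quarter of the right side of [edge_bound], so the two orientations together
   produce half of the exchange terms. *)
rewrite -[leRHS]subr0 -[X in _ - X](mulr0 2^-1) -[X in _ - 2^-1 * X]zero.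
rewrite !mulr_sumr -sumrB; apply: ler_sum => i _.
rewrite !mulr_sumr -sumrB; apply: ler_sum => x _.
have [->|px] := eqVneq (p i x) 0; first by rewrite !(mulr0, mul0r) subr0.
have kp0 := le_trans K20 (K2p i x px); have km0 := le_trans K20 (K2m i x px).
have tangent1 := Phi_tangent x (u i x).
(* The tangent inequality on the reversed edge, brought back to [(x, u i x)] by the symmetry of
   [Phi]. *)
have tangent2 a b : Phi a b <= Phi x (u i x) + D2 (u i x) x * (rho a - rho x)
    + D1 (u i x) x * (rho b - rho (u i x)).
  by rewrite addrAC PhiC (PhiC x).
have := edge_bound _ _ _ _ px kp0 km0 tangent1; have := edge_bound _ _ _ _ px kp0 km0 tangent2.
set S1 := \sum_j _; set S2 := \sum_(j | _) _; set S3 := \sum_(j | _) _.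
have := K1le i x px; have := K2p i x px; have := K2m i x px; have := Mle x (u i x).
rewrite /edge_form (PhiC (u i x) x) (PsiC (u i x) x).
have := Phi_ge0 x (u i x); have := Phi_ge0 x x; have := Phi_ge0 (u i x) (u i x).
have : 0 <= Psi x (u i x) by exact: sqr_ge0.
set f := Phi x (u i x); set fxx := Phi x x; set fyy := Phi (u i x) (u i x).
set P := Psi x (u i x); set k1 := kplus i x; set k2 := kminus i x.
set dp := psi x - psi (u i x); set dg := gen psi x - gen psi (u i x).
rewrite -(opprB (psi x)) -(opprB (gen psi x)) -/dp -/dg.
set s1 := D1 x (u i x) * _ + _; set s2 := D2 (u i x) x * _ + _.
move=> P0 fyy0 fxx0 f0 hM hk2 hk1 hK e1 e2.
have w0 : 0 <= m x * p i x by rewrite mulr_ge0.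
(* The diagonal part [k1 * fyy + k2 * fxx] is at least [2 * M * K2 * f], and [(k1 + k2) * f] is at
   least [K1 * f]; half of their sum has the constant [K1 / 2 + M * K2]. *)
have hMP : 0 <= K2 * (fxx + fyy - 2 * M * f) * P by rewrite mulr_ge0 // mulr_ge0 ?subr_ge0.
have hk1P : 0 <= (k1 - K2) * fyy * P by rewrite mulr_ge0 // mulr_ge0 ?subr_ge0.
have hk2P : 0 <= (k2 - K2) * fxx * P by rewrite mulr_ge0 // mulr_ge0 ?subr_ge0.
have hKP : 0 <= (k1 + k2 - K1) * f * P by rewrite mulr_ge0 // mulr_ge0 ?subr_ge0.
rewrite [D1 (u i x) x * _ + _]addrC -/s2.
move: e1 e2 w0; set w := m x * p i x; set S := S1 + S2 + S3 => e1 e2 w0.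
have hw : 0 <= w * (4^-1 * (s1 + s2) * P - f * dp * dg - 2^-1 * S
                    - (K1 / 2 + M * K2) * f * P).
  by apply: mulr_ge0 => //; lra.
rewrite -subr_ge0; apply: (le_trans hw); rewrite le_eqVlt; apply/orP; left.
by apply/eqP; field.
Qed.

End Functionals.

End BirthDeath.

(** * Commutation, path independence and balance for the walk on N^d *)

Section Moves.
Variable d : nat.
Implicit Types (eta : state d) (i j : 'I_d).

Lemma move_upC i j eta :
  move_act (move_up i) (move_act (move_up j) eta)
  = move_act (move_up j) (move_act (move_up i) eta).
Proof. by apply/ffunP => k; rewrite !ffunE /=; do 2 case: eqP. Qed.

Lemma move_downC i j eta :
  move_act (move_down i) (move_act (move_down j) eta)
  = move_act (move_down j) (move_act (move_down i) eta).
Proof. by apply/ffunP => k; rewrite !ffunE /=; do 2 case: eqP. Qed.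

Lemma move_upK i eta : move_act (move_down i) (move_act (move_up i) eta) = eta.
Proof. by apply/ffunP => k; rewrite !ffunE /=; case: eqP; rewrite ?subn1. Qed.

End Moves.

Section RateIdentities.
Context {R : realType} {d : nat}.
Variables Vp Vm : state d -> R.
Implicit Types (eta : state d) (i j : 'I_d).

Lemma rate_ge0 eta g : 0 <= rate Vp Vm eta g.
Proof. by rewrite /rate; case: ifP => _; [|case: ifP => _]; rewrite ?expR_ge0. Qed.

Lemma rate_up_gt0 eta i : 0 < rate Vp Vm eta (move_up i).
Proof. exact: expR_gt0. Qed.

Lemma rate_down_eq0 eta i : (rate Vp Vm eta (move_down i) == 0) = (eta i == 0)%N.
Proof.
rewrite /rate /= lt0n; have [_|_] := eqVneq (eta i) 0%N; first exact: eqxx.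
by rewrite gt_eqF ?expR_gt0.
Qed.

(** The increments of [Vp] telescope along either path to the same end point. *)
Lemma rate_up_path i j eta :
  rate Vp Vm eta (move_up i) * rate Vp Vm (move_act (move_up i) eta) (move_up j)
  = rate Vp Vm eta (move_up j) * rate Vp Vm (move_act (move_up j) eta) (move_up i).
Proof. by rewrite /rate /= -!expRD (move_upC _ i j); congr expR; ring. Qed.

Lemma rate_down_path i j eta :
  rate Vp Vm eta (move_down i) * rate Vp Vm (move_act (move_down i) eta) (move_down j)
  = rate Vp Vm eta (move_down j) * rate Vp Vm (move_act (move_down j) eta) (move_down i).
Proof.
have [<-//|ij] := eqVneq i j.
rewrite /rate /= !ffunE (negPf ij) eq_sym (negPf ij) (move_downC _ i j).
case: ifP => _; case: ifP => _; rewrite ?mul0r ?mulr0 // -!expRD.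
by congr expR; ring.
Qed.

Lemma gibbs_balance i eta :
  gibbs_weight Vp Vm eta * rate Vp Vm eta (move_up i)
  = gibbs_weight Vp Vm (move_act (move_up i) eta)
    * rate Vp Vm (move_act (move_up i) eta) (move_down i).
Proof.
rewrite /rate /= move_upK !ffunE eqxx /= /gibbs_weight -!expRD.
by congr expR; ring.
Qed.

End RateIdentities.

(** * The localized chain as a birth-death chain *)

Section Box.
Context {d N : nat}.
Implicit Types (x : box d N) (i j k : 'I_d).

Lemma box_upE i x k :
  box_act (move_up i) x k = (if k == i then x k + (x k < N) else x k)%N :> nat.
Proof.
rewrite ffunE /=; case: ifP => // _; rewrite inordK //.
by case: (ltnP (x k) N) => xN; rewrite ?addn1 ?addn0 ?ltn_ord.
Qed.

Lemma box_downE i x k :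
  box_act (move_down i) x k = (if k == i then x k - 1 else x k)%N :> nat.
Proof.
rewrite ffunE /=; case: ifP => // _; rewrite inordK //.
by rewrite (leq_ltn_trans (leq_subr _ _)).
Qed.

Lemma emb_up i x : (x i < N)%N ->
  emb (box_act (move_up i) x) = move_act (move_up i) (emb x).
Proof.
move=> xN; apply/ffunP => k; rewrite [LHS]ffunE box_upE !ffunE /=.
by case: eqP => // ->; rewrite xN addn1.
Qed.

Lemma emb_down i x : emb (box_act (move_down i) x) = move_act (move_down i) (emb x).
Proof. by apply/ffunP => k; rewrite [LHS]ffunE box_downE !ffunE. Qed.

Lemma box_upC i j x :
  box_act (move_up i) (box_act (move_up j) x)
  = box_act (move_up j) (box_act (move_up i) x).
Proof. by apply/ffunP => k; rewrite !ffunE /=; do 2 case: eqP. Qed.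

Lemma box_up_downC i j x : i != j ->
  box_act (move_up i) (box_act (move_down j) x)
  = box_act (move_down j) (box_act (move_up i) x).
Proof.
move=> ij; apply/ffunP => k; rewrite !ffunE /=.
by have [->|ki] := eqVneq k i; rewrite ?(negPf ij) //; case: eqP.
Qed.

Lemma box_upK i x : (x i < N)%N -> box_act (move_down i) (box_act (move_up i) x) = x.
Proof.
move=> xN; apply/ffunP => k; apply: val_inj; rewrite /= box_downE box_upE.
by case: eqP => // ->; rewrite xN addn1 subn1.
Qed.

Lemma box_downK i x : (0 < x i)%N -> box_act (move_up i) (box_act (move_down i) x) = x.
Proof.
move=> x0; apply/ffunP => k; apply: val_inj; rewrite /= box_upE box_downE.
case: eqP => // ->; rewrite subn1 prednK //.
by rewrite -ltnS ltn_ord addn1 prednK.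
Qed.

End Box.

Section BoxRates.
Context {R : realType} {d N : nat}.
Variables Vp Vm : state d -> R.
Implicit Types (x : box d N) (i j : 'I_d).

Definition up_rate i x : R := box_rate Vp Vm x (move_up i).
Definition down_rate i x : R := box_rate Vp Vm x (move_down i).

Lemma up_rateE i x : (x i < N)%N -> up_rate i x = rate Vp Vm (emb x) (move_up i).
Proof. by move=> xN; rewrite /up_rate /box_rate /= xN mulr1. Qed.

Lemma up_rate_ge0 i x : 0 <= up_rate i x.
Proof. by rewrite mulr_ge0 ?rate_ge0 ?ler0n. Qed.

Lemma down_rate_ge0 i x : 0 <= down_rate i x.
Proof. exact: rate_ge0. Qed.

Lemma up_rate_neq0 i x : (up_rate i x != 0) = (x i < N)%N.
Proof.
rewrite mulf_eq0 gt_eqF ?rate_up_gt0 //=.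
by case: ltnP; rewrite ?oner_eq0 ?eqxx.
Qed.

Lemma down_rate_neq0 i x : (down_rate i x != 0) = (0 < x i)%N.
Proof. by rewrite rate_down_eq0 ffunE lt0n. Qed.

Lemma up_rate_path i j x :
  up_rate i x * up_rate j (box_act (move_up i) x)
  = up_rate j x * up_rate i (box_act (move_up j) x).
Proof.
have [<-//|ij] := eqVneq i j.
have val0 k (y : box d N) : (N <= y k)%N -> up_rate k y = 0.
  by move=> yN; apply/eqP; apply: contraTT yN; rewrite up_rate_neq0 -ltnNge.
(* If [x i = N], both sides vanish, since a move in direction [j != i] leaves that coordinate at
   [N]. *)
have [xi|xi] := ltnP (x i) N; last first.
  by rewrite (val0 i x xi) (val0 i (box_act _ _)) ?mul0r ?mulr0 // box_upE (negPf ij).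
have [xj|xj] := ltnP (x j) N; last first.
  rewrite (val0 j x xj) (val0 j (box_act _ _)) ?mul0r ?mulr0 // box_upE.
  by rewrite eq_sym (negPf ij).
have up_neq a b (ab : a != b) : (x a < N)%N -> (box_act (move_up b) x a < N)%N.
  by rewrite box_upE (negPf ab).
rewrite (up_rateE i x xi) (up_rateE j x xj) up_rateE ?up_neq 1?eq_sym //.
by rewrite up_rateE ?up_neq // !emb_up // rate_up_path.
Qed.

Lemma down_rate_path i j x :
  down_rate i x * down_rate j (box_act (move_down i) x)
  = down_rate j x * down_rate i (box_act (move_down j) x).
Proof. by rewrite /down_rate /box_rate /= !emb_down rate_down_path. Qed.

Lemma box_measure_ge0 x : 0 <= box_measure Vp Vm x.
Proof.
have ge0 eta : 0 <= rev_measure Vp Vm eta.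
  rewrite mulr_ge0 ?expR_ge0 // invr_ge0 fine_ge0 // esum_ge0 // => xi _.
  by rewrite lee_fin expR_ge0.
by rewrite divr_ge0 // sumr_ge0.
Qed.

Lemma box_balance i x : up_rate i x != 0 ->
  box_measure Vp Vm x * up_rate i x
  = box_measure Vp Vm (box_act (move_up i) x) * down_rate i (box_act (move_up i) x).
Proof.
rewrite up_rate_neq0 => xi; rewrite up_rateE // /down_rate /box_rate /=.
rewrite /box_measure /rev_measure emb_up //; have := gibbs_balance Vp Vm i (emb x).
set S := (\sum_xi _)^-1; set Z := (fine _)^-1 => e.
rewrite mulrAC -(mulrA Z) e; ring.
Qed.

Lemma box_genE (f : box d N -> R) x :
  box_gen Vp Vm f x = gen (fun i => box_act (move_up i)) (fun i => box_act (move_down i))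
    up_rate down_rate f x.
Proof.
rewrite /box_gen -(pair_bigA _ (fun i b => box_rate Vp Vm x (i, b) *
   (f (box_act (i, b) x) - f x))) /=.
by apply: eq_bigr => i _; rewrite big_bool.
Qed.

Lemma sum_box_support (F : box d N -> box d N -> R) :
  \sum_(p in box_support Vp Vm N)
    box_measure Vp Vm p.1 * box_rate Vp Vm p.1 p.2 * F p.1 (box_act p.2 p.1)
  = \sum_x \sum_i (box_measure Vp Vm x * up_rate i x * F x (box_act (move_up i) x)
       + box_measure Vp Vm x * down_rate i x * F x (box_act (move_down i) x)).
Proof.
transitivity (\sum_(p : box d N * move d)
    box_measure Vp Vm p.1 * box_rate Vp Vm p.1 p.2 * F p.1 (box_act p.2 p.1)).
  rewrite big_mkcond; apply: eq_bigr => -[x g] _; rewrite inE /=.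
  case: ltP => // le0; have -> : box_rate Vp Vm x g = 0; last by rewrite mulr0 mul0r.
  apply/le_anti; rewrite le0 /=; case: g {le0} => i [].
    exact: up_rate_ge0.
  exact: down_rate_ge0.
rewrite -(pair_bigA _ (fun x g =>
  box_measure Vp Vm x * box_rate Vp Vm x g * F x (box_act g x))) /=.
apply: eq_bigr => x _.
rewrite -(pair_bigA _ (fun i b => box_measure Vp Vm x * box_rate Vp Vm x (i, b)
  * F x (box_act (i, b) x))) /=.
by apply: eq_bigr => i _; rewrite big_bool.
Qed.

(** Equality can fail for [j = i] and [x i = N - 1], where the move up is blocked at the upper end
    of the edge only. *)
Lemma up_rate_grad i j x : (x i < N)%N ->
  up_rate j (box_act (move_up i) x) - up_rate j x
  <= grad_rate Vp Vm i (emb x) (move_up j) * (x j < N)%:R.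
Proof.
move=> xi; rewrite /up_rate /box_rate /= emb_up // /grad_rate mulrBl lerB //.
rewrite ler_wpM2l ?rate_ge0 // ler_nat box_upE.
by case: eqP => // ->; rewrite xi; case: ltnP.
Qed.

Lemma down_rate_grad i j x : (x i < N)%N ->
  down_rate j (box_act (move_up i) x) - down_rate j x
  = grad_rate Vp Vm i (emb x) (move_down j).
Proof. by move=> xi; rewrite /down_rate /box_rate /= emb_up. Qed.

Section Monotone.
Hypothesis hup : forall (eta : state d) (i j : 'I_d),
  grad_rate Vp Vm i eta (move_up j) <= 0.
Hypothesis hdown : forall (eta : state d) (i j : 'I_d),
  0 <= grad_rate Vp Vm i eta (move_down j).

Lemma up_rate_anti i j x : up_rate i x != 0 ->
  up_rate j (box_act (move_up i) x) <= up_rate j x.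
Proof.
rewrite up_rate_neq0 => xi; rewrite -subr_le0 (le_trans (up_rate_grad i j x xi)) //.
by rewrite mulr_le0_ge0 // ler0n.
Qed.

Lemma down_rate_mono i j x : up_rate i x != 0 ->
  down_rate j x <= down_rate j (box_act (move_up i) x).
Proof. by rewrite up_rate_neq0 => xi; rewrite -subr_ge0 down_rate_grad. Qed.

(** Truncation can only lower the up rate at the upper end, which enters [kplus] with a minus
    sign. *)
Lemma kplus_box_ge i x : up_rate i x != 0 ->
  kappa_plus Vp Vm (emb x) i
  <= kplus (fun i => box_act (move_up i)) up_rate down_rate i x.
Proof.
rewrite up_rate_neq0 => xi; rewrite /kappa_plus /kplus lerD //.
  by rewrite lerNl opprB (le_trans (up_rate_grad i i x xi)) // xi mulr1.
by rewrite lerN2; apply: ler_sum => j _; rewrite down_rate_grad.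
Qed.

(** For [j != i] the truncation is the same at both ends of the edge, so it only deletes gradients
    that are nonpositive by [hup]. *)
Lemma kminus_box_ge i x : up_rate i x != 0 ->
  kappa_minus Vp Vm (emb x) i
  <= kminus (fun i => box_act (move_up i)) up_rate down_rate i x.
Proof.
rewrite up_rate_neq0 => xi; rewrite /kappa_minus /kminus down_rate_grad // lerD2l.
apply: ler_sum => j ji.
have -> : up_rate j (box_act (move_up i) x) - up_rate j x =
    grad_rate Vp Vm i (emb x) (move_up j) * (x j < N)%:R.
  by rewrite /up_rate /box_rate /= emb_up // box_upE (negPf ji) /grad_rate mulrBl.
by case: ltnP; rewrite ?mulr1 ?mulr0.
Qed.

End Monotone.

End BoxRates.

Theorem theorem4p10 (R : realType) (d : nat) (hd : (1 <= d)%N)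
  (Vp Vm : state d -> R)
  (hZ : (partition_function Vp Vm < +oo)%E)
  (hmc : (total_rate Vp Vm < +oo)%E)
  (hup : forall (eta : state d) (i j : 'I_d),
    grad_rate Vp Vm i eta (move_up j) <= 0)
  (hdown : forall (eta : state d) (i j : 'I_d),
    0 <= grad_rate Vp Vm i eta (move_down j))
  (hkp : forall (eta : state d) (i : 'I_d), 0 <= kappa_plus Vp Vm eta i)
  (hkm : forall (eta : state d) (i : 'I_d), 0 <= kappa_minus Vp Vm eta i)
  (theta : R * R -> R) (htheta : weight_function theta)
  (N : nat) (hN : (2 <= N)%N)
  (rho psi : box d N -> R) (hrho : forall eta : box d N, 0 < rho eta) :
  (kappa_star Vp Vm / 2 + M_weight theta * kappa_star_bar Vp Vm)
    * action_A Vp Vm theta rho psi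
  <= functional_B Vp Vm theta rho psi.
Proof.
have inf_le (f : state d -> 'I_d -> R) eta i :
    (forall xi j, 0 <= f xi j) -> inf_state_idx f <= f eta i.
  move=> f0; apply: ge_inf; last by exists (eta, i).
  by exists 0 => _ [p _ <-]; exact: f0.
have inf_ge0 (f : state d -> 'I_d -> R) :
    (forall xi j, 0 <= f xi j) -> 0 <= inf_state_idx f.
  move=> f0; apply: lb_le_inf; last by move=> _ [p _ <-]; exact: f0.
  (* [hd] supplies an index, so the infimum is over a nonempty set. *)
  by exists (f [ffun=> 0%N] (Ordinal hd)), ([ffun=> 0%N], Ordinal hd).
have qrho x y : quadrant (rho x, rho y) by split; exact: hrho.
pose u (i : 'I_d) (x : box d N) := box_act (move_up i) x.
pose l (i : 'I_d) (x : box d N) := box_act (move_down i) x.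
have upK i x : up_rate Vp Vm i x != 0 -> l i (u i x) = x.
  by rewrite up_rate_neq0; exact: box_upK.
have downK i x : down_rate Vp Vm i x != 0 -> u i (l i x) = x.
  by rewrite down_rate_neq0; exact: box_downK.
have down_up i x : up_rate Vp Vm i x != 0 -> down_rate Vp Vm i (u i x) != 0.
  by rewrite up_rate_neq0 down_rate_neq0 box_upE eqxx => ->; rewrite addn1.
have up_down i x : down_rate Vp Vm i x != 0 -> up_rate Vp Vm i (l i x) != 0.
  rewrite up_rate_neq0 down_rate_neq0 box_downE eqxx subn1 => x0.
  by rewrite prednK // -ltnS.
have Phi_ge0 x y : 0 <= theta (rho x, rho y) by exact: weight_ge0.
have PhiC x y : theta (rho x, rho y) = theta (rho y, rho x) by exact: weight_sym.
have tangent x y a b := weight_tangent htheta _ _ _ _ (qrho x y) (qrho a b).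
have Mle x y := M_weight_le htheta _ _ (qrho x y).
have k2_ge0 : 0 <= kappa_star_bar Vp Vm by rewrite le_min !inf_ge0.
have k1le i x : up_rate Vp Vm i x != 0 -> kappa_star Vp Vm <=
    kplus u (up_rate Vp Vm) (down_rate Vp Vm) i x
    + kminus u (up_rate Vp Vm) (down_rate Vp Vm) i x.
  move=> px; apply: (le_trans (inf_le _ (emb x) i _)) => [xi j|].
    by rewrite addr_ge0.
  by apply: lerD; [exact: kplus_box_ge | exact: kminus_box_ge].
have k2p i x : up_rate Vp Vm i x != 0 -> kappa_star_bar Vp Vm <=
    kplus u (up_rate Vp Vm) (down_rate Vp Vm) i x.
  move=> px; apply: le_trans (kplus_box_ge _ _ _ _ px).
  by rewrite ge_min inf_le.
have k2m i x : up_rate Vp Vm i x != 0 -> kappa_star_bar Vp Vm <=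
    kminus u (up_rate Vp Vm) (down_rate Vp Vm) i x.
  move=> px; apply: le_trans (kminus_box_ge _ _ hup _ _ px).
  by rewrite ge_min [X in _ || X]inf_le ?orbT.
have bound := sum_edge_form_ge _ _ _ _ _ (box_measure_ge0 Vp Vm) (up_rate_ge0 Vp Vm)
  (down_rate_ge0 Vp Vm) upK downK down_up up_down (box_balance Vp Vm) box_upC box_up_downC
  (up_rate_path Vp Vm) (down_rate_path Vp Vm) rho psi _ _ _ Phi_ge0 PhiC tangent
  (down_rate_mono Vp Vm hdown) (up_rate_anti Vp Vm hup) _ _ _ k2_ge0 k1le k2p k2m Mle.
have -> : action_A Vp Vm theta rho psi = 2^-1 * \sum_x \sum_i
    (box_measure Vp Vm x * up_rate Vp Vm i x *
       (theta (rho x, rho (box_act (move_up i) x))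
        * (psi x - psi (box_act (move_up i) x)) ^+ 2)
     + box_measure Vp Vm x * down_rate Vp Vm i x *
       (theta (rho x, rho (box_act (move_down i) x))
        * (psi x - psi (box_act (move_down i) x)) ^+ 2)).
  rewrite -(sum_box_support Vp Vm (fun x y => theta (rho x, rho y) * (psi x - psi y) ^+ 2)).
  by congr (_ * _); apply: eq_bigr => p _; rewrite mulrA.
apply: (le_trans bound); rewrite -(sum_box_support Vp Vm (edge_form _ _ _ _ _ _ _ _ _)).
rewrite /functional_B /functional_C /functional_D !mulr_sumr -sumrB.
rewrite le_eqVlt; apply/orP; left; apply/eqP/eq_bigr => p _.
(* [edge_form] carries the prefactors 1/4 of C and 1/2 of D. *)
rewrite !box_genE /edge_form -/u -/l; ring.
Qed.
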